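(* Let $\mathcal{A}$ be a set of $n$-vertex, $K_{r+1}$-free graphs. Let $m = \max\{e(G):G\in \mathcal{A}\}$. Let $G \in \mathcal{A}$. For every $t \ge 2$, \[ k^t(G) \le k^t(\mathrm{CT}_r(m)), \] and if $\mathrm{CT}_r(m)\in\mathcal{A}$ then this upper bound is tight, as equality holds if $G \cong \mathrm{CT}_r(m)$.
   Context: Graphs are simple. $e(G)$ is the number of edges of $G$, and $k^t(G)$ is the number of $t$-cliques of $G$ (sets of $t$ pairwise adjacent vertices). The colex order on finite subsets of $\mathbb{N}$ is given by $A<_C B$ iff $\max(A\triangle B)\in B$. The $r$-partite colex Turán graph on $m$ edges, $\mathrm{CT}_r(m)$, has as edges the first $m$ pairs $\{i,j\}$ of natural numbers with $i\not\equiv j\pmod r$ in colex order; its vertex set is the union of all of these edges. *)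

(* Defs.v *)
From HB Require Import structures.
From mathcomp Require Import all_boot finmap.

Set Implicit Arguments.
Unset Strict Implicit.
Unset Printing Implicit Defensive.

Structure sgraph := SGraph {
  vertex :> finType;
  adj : rel vertex;
  adj_sym : symmetric adj;
  adj_irrefl : irreflexive adj }.

Definition edges (G : sgraph) : {set {set G}} :=
  [set e | [exists x, exists y, adj x y && (e == [set x; y])]].

Definition num_edges (G : sgraph) : nat := #|edges G|.

Definition clique (G : sgraph) (S : {set G}) : bool :=
  [forall x in S, forall y in S, (x != y) ==> adj x y].

Definition num_cliques (t : nat) (G : sgraph) : nat :=
  #|[set S : {set G} | (#|S| == t) && clique S]|.

Definition clique_free (s : nat) (G : sgraph) : Prop :=
  forall S : {set G}, clique S -> #|S| <> s.

Definition isomorphic (G H : sgraph) : Prop :=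
  exists2 f : G -> H, bijective f & forall x y, adj (f x) (f y) = adj x y.

Definition max_num_edges (A : sgraph -> Prop) (m : nat) : Prop :=
  (exists2 G, A G & num_edges G = m) /\ (forall G, A G -> num_edges G <= m).

Section Colex.

Local Open Scope fset_scope.

(* The test [A != B] is needed: the maximum of an empty sequence is 0. *)
Definition colex_lt (A B : {fset nat}) : bool :=
  (A != B) && (\max_(x <- (A `\` B) `|` (B `\` A)) x \in B).

Definition colex_le (A B : {fset nat}) : bool := (A == B) || colex_lt A B.

Definition turan_pairs (r N : nat) : seq {fset nat} :=
  [seq [fset p.1; p.2] |
     p <- [seq (i, j) | j <- iota 0 N, i <- iota 0 j] & p.1 != p.2 %[mod r]].

(* The first [m] pairs {i, j} with i <> j mod r, in colex order. It suffices to
   sort the pairs contained in {0, ..., m}: they form an initial segment of all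
   such pairs, of size at least [m] unless r = 1, since {j - 1, j} is such a
   pair for each 0 < j <= m. If r = 1 there are no pairs at all. *)
Definition colex_turan_edges (r m : nat) : seq {fset nat} :=
  take m (sort colex_le (turan_pairs r m.+1)).

Definition colex_turan_vertices (r m : nat) : {fset nat} :=
  \bigcup_(e <- colex_turan_edges r m) e.

Definition colex_turan_adj (r m : nat) : rel (colex_turan_vertices r m) :=
  fun x y => [fset val x; val y] \in colex_turan_edges r m.

Lemma colex_turan_adj_sym r m : symmetric (@colex_turan_adj r m).
Proof. by move=> x y; rewrite /colex_turan_adj fsetUC. Qed.

Lemma turan_pairsP r N (e : {fset nat}) :
  reflect (exists i j, [/\ i < j < N, i != j %[mod r] & e = [fset i; j]])
          (e \in turan_pairs r N).
Proof.
apply: (iffP mapP) => [[p]|[i [j [/andP[ij jN] nij ->]]]].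
  rewrite mem_filter => /andP[np /allpairsPdep[j [i [jN ij dp]]]] ->.
  rewrite {}dp /= in np *; exists i, j; split=> //.
  by move: jN ij; rewrite !mem_iota /= !add0n => -> ->.
exists (i, j) => //; rewrite mem_filter nij /=.
by apply/allpairsPdep; exists j, i; rewrite !mem_iota /= !add0n.
Qed.

Lemma colex_turan_adj_irrefl r m : irreflexive (@colex_turan_adj r m).
Proof.
move=> x; apply/negP => /mem_take; rewrite mem_sort.
case/turan_pairsP=> i [j [/andP[ij _] _ /fsetP eij]].
have := eij i; have := eij j; rewrite !inE !eqxx ?orbT /= !orbb.
by move=> /eqP dj /eqP di; rewrite di dj ltnn in ij.
Qed.

Definition CT (r m : nat) : sgraph :=
  SGraph (@colex_turan_adj_sym r m) (@colex_turan_adj_irrefl r m).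

End Colex.

(* Main.v *)
Require Import Defs.
From mathcomp Require Import all_boot finmap zify.

Set Implicit Arguments.
Unset Strict Implicit.
Unset Printing Implicit Defensive.

(** Write T_s(n) for the Turan graph on the vertices 0, ..., n - 1, in which
    two vertices are adjacent when they are incongruent mod s. If m is
    e(T_r(N)) + c, with c less than the degree of the vertex N in T_r(N + 1),
    then CT_r(m) is T_r(N) together with the vertex N, joined to the first c
    vertices outside its class. Those c vertices span a copy of T_{r-1}(c), so
    CT_r(m) has k^t(T_r(N)) + k^{t-1}(T_{r-1}(c)) cliques of size t.
    [CT_cliques_ge] finds that many cliques in CT_r(m), and
    [cliques_in_le_colex] shows by induction on r that G has no more.

    For t = 2 this is the bound on the number of edges, and for r = 2 a
    K_{r+1}-free graph has no t-cliques with t > 2. So let G be K_{r+1}-free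
    with r > 2, and let t > 2. Let v be a vertex whose neighbourhood A spans
    the largest number of (t-1)-cliques, and delete the vertices outside A one
    at a time. If d_i is the degree of the i-th of them at its deletion, then e(G) = e(A) + sum_i d_i and
      k^t(G) <= k^t(A) + sum_i min(k^{t-1}(A), k^{t-1}(T_{r-1}(d_i))),
    by the choice of v and by Zykov's theorem ([cliques_in_le_turan]) in the
    K_r-free neighbourhoods. As A is K_r-free too, the induction hypothesis
    bounds both k^t(A) and k^{t-1}(A) by their values for CT_{r-1}(e(A)). The
    right-hand side is then exactly the number of t-cliques of an r-partite
    graph with as many edges as G: CT_{r-1}(e(A)) with one further class, whose
    i-th vertex is joined to the first d_i vertices.

    What remains is an optimisation problem about natural numbers, to show that
    no graph of this shape beats the colex Turan graph. The incomplete vertex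
    of CT_{r-1}(e(A)) is eliminated first: it is either moved to the new class
    or completed with edges taken from that class ([link_dominated]). This
    leaves a T_{r-1}(y) with one further class. Convexity of the clique counts
    makes all but one vertex of that class complete or isolated
    ([stack_normal]), and exchanging vertices between the class and T_{r-1}(y)
    balances the sizes ([stack_dominated]). In each exchange every edge that is
    lost lies in at most as many t-cliques as an edge that is gained. *)

(** * Clique counts of Turan graphs *)

(** The degree of the vertex n in T_r(n + 1), and also the number of vertices
    of T_r(n) outside a smallest class. *)
Definition turan_deg (r n : nat) : nat := n - n %/ r.

(** k^t(T_r(n)), by recursion on the number of classes: a smallest class has
    n / r vertices, and the other classes form a Turan graph with one class
    fewer. The value at r = 0 is meaningful for n = 0 only. *)
Fixpoint turan_cliques (r t n : nat) : nat :=
  if r is r'.+1 then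
    turan_cliques r' t (turan_deg r n) +
    (if t is t'.+1 then n %/ r * turan_cliques r' t' (turan_deg r n) else 0)
  else t == 0.

Lemma turan_cliques_class r t n :
  turan_cliques r.+1 t.+1 n =
  turan_cliques r t.+1 (turan_deg r.+1 n) +
  n %/ r.+1 * turan_cliques r t (turan_deg r.+1 n).
Proof. by []. Qed.

Lemma turan_cliques_no_class t n : turan_cliques 0 t n = (t == 0).
Proof. by []. Qed.

Lemma turan_cliques0 r n : turan_cliques r 0 n = 1.
Proof. by elim: r n => //= r IH n; rewrite IH addn0. Qed.

(* From here on unification must not unfold the recursion. *)
#[local] Opaque turan_cliques.

Lemma turan_deg_le r n : turan_deg r n <= n.
Proof. exact: leq_subr. Qed.

Lemma turan_degK r n : turan_deg r n + n %/ r = n.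
Proof. by rewrite subnK // leq_div. Qed.

Lemma turan_cliques1 r n : 0 < r -> turan_cliques r 1 n = n.
Proof.
case: r => // r _; elim: r n => [|r IH] n; rewrite turan_cliques_class.
  by rewrite !turan_cliques_no_class divn1 muln1.
by rewrite IH turan_cliques0 muln1 turan_degK.
Qed.

Lemma turan_cliques_small r t n : r < t -> turan_cliques r t n = 0.
Proof.
elim: r t n => [|r IH] [|t] n // rt.
by rewrite turan_cliques_class !IH ?muln0 // ltnW.
Qed.

Lemma turan_cliques_n0 r t : turan_cliques r t.+1 0 = 0.
Proof. 
elim: r t => [|r IH] t //.
by rewrite turan_cliques_class /turan_deg div0n subn0 IH.
 Qed.

(** The alternative is whether r + 1 divides n + 1: only then does passing from
    n to n + 1 enlarge the smallest class. *)
Lemma turan_degS r n :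
  (n.+1 %/ r.+1 = n %/ r.+1 /\ turan_deg r.+1 n.+1 = (turan_deg r.+1 n).+1
     /\ turan_deg r.+1 n %/ r = n %/ r.+1) \/
  (n.+1 %/ r.+1 = (n %/ r.+1).+1 /\ turan_deg r.+1 n.+1 = turan_deg r.+1 n).
Proof.
have := divn_eq n r.+1; have := ltn_pmod n (ltn0Sn r); rewrite /turan_deg.
move: (n %/ r.+1) (n %% r.+1) => q s; rewrite ltnS leq_eqVlt.
case/orP=> [/eqP->|sr] ->.
  right; have -> : (q * r.+1 + r).+1 = q.+1 * r.+1 by lia.
  by rewrite mulnK //; lia.
left; have -> : (q * r.+1 + s).+1 = q * r.+1 + s.+1 by lia.
rewrite divnMDl // (divn_small (m := s.+1)) ?ltnS // addn0.
split=> //; split; first by lia.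
have -> : q * r.+1 + s - q = q * r + s by lia.
by rewrite divnMDl ?(leq_ltn_trans _ sr) // divn_small // addn0.
Qed.

(** The neighbours of the last vertex of T_{r+1}(n + 1) span T_r. *)
Lemma turan_cliquesS r t n :
  turan_cliques r.+1 t.+1 n.+1 =
  turan_cliques r.+1 t.+1 n + turan_cliques r t (turan_deg r.+1 n).
Proof.
elim: r t n => [|r IH] t n; rewrite !(turan_cliques_class _ _ n.+1) !(turan_cliques_class _ _ n).
  by rewrite !turan_cliques_no_class !divn1; case: t => [|t] /=; lia.
case: (turan_degS r.+1 n) => [[-> [-> dq]]|[-> ->]]; last by rewrite mulSn addnA addnAC.
rewrite IH; case: t => [|t]; first by rewrite !turan_cliques0; lia.
by rewrite IH (turan_cliques_class r t (turan_deg r.+2 n)) dq !mulnDr; lia.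
Qed.

Lemma turan_deg_mono r : {homo turan_deg r : m n / m <= n}.
Proof.
apply: homo_leq => [//|m n p|n]; first exact: leq_trans.
case: r => [|r]; first by rewrite /turan_deg !divn0 !subn0.
by case: (turan_degS r n) => [[_ [-> _]]|[_ ->]].
Qed.

Lemma turan_cliques_mono r t : {homo turan_cliques r t : m n / m <= n}.
Proof.
apply: homo_leq => [//|m n p|n]; first exact: leq_trans.
case: r t => [|r] [|t] //; first by rewrite !turan_cliques0.
by rewrite turan_cliquesS leq_addr.
Qed.

Lemma turan_edgesS r n :
  turan_cliques r.+2 2 n.+1 = turan_cliques r.+2 2 n + turan_deg r.+2 n.
Proof. by rewrite turan_cliquesS turan_cliques1. Qed.

Lemma turan_deg_gt0 r n : 0 < n -> 0 < turan_deg r.+2 n.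
Proof. by move=> n0; rewrite subn_gt0 ltn_Pdiv. Qed.

(** The left-hand side counts the cliques of T_k(y) joined to an independent
    set of b vertices. Some vertex of this graph has degree at most that of the
    last vertex of T_{k+1}(y + b): a vertex of the independent set if y is small
    enough, and otherwise the last vertex of T_k(y). Delete it. *)
Lemma turan_join_le k u y b :
  turan_cliques k u.+1 y + b * turan_cliques k u y
    <= turan_cliques k.+1 u.+1 (y + b).
Proof.
elim: k u y b => [|k IHk] u y b.
  by rewrite turan_cliques_class !turan_cliques_no_class divn1; case: u => /=; lia.
move dn : (y + b) => n; elim: n y b dn => [|n IHn] y b dn.
  have [-> ->] : y = 0 /\ b = 0 by lia.
  by rewrite turan_cliques_n0.
rewrite turan_cliquesS; set a := turan_deg _ n.
have [ya|ya] := leqP y a.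
  case: b dn => [|b] dn; first by have := turan_deg_le k.+2 n; rewrite -/a; lia.
  have /IHn : y + b = n by lia.
  have := turan_cliques_mono k.+1 u ya; lia.
case: y ya dn => // y ya dn; have {}dn : y + b = n by lia.
rewrite turan_cliquesS; have := IHn y b dn.
have le_a : turan_deg k.+1 y + b <= a.
  rewrite /a -dn /turan_deg in ya *.
  suff : (y + b) %/ k.+2 <= y %/ k.+1 by have := leq_div y k.+1; lia.
  rewrite leq_divRL //; have := leq_trunc_div (y + b) k.+2; lia.
case: u {IHn} => [|u]; first by rewrite !turan_cliques0; lia.
rewrite turan_cliquesS.
have := IHk u (turan_deg k.+1 y) b; have := turan_cliques_mono k.+1 u.+1 le_a.
by rewrite mulnDr; lia.
Qed.

(** Let a vertex be joined to the first x vertices of T_{k+1}, and then to the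
    next j. Each new edge creates the cliques of a Turan graph on the common
    neighbours of its ends, and b bounds the vertices reached, hence the number
    of these neighbours. In this form the lemma compares edges that are lost
    with edges that are gained. *)
Lemma turan_cliques_add_le k u x j b :
  x + j <= b.+1 ->
  turan_cliques k.+1 u.+1 (x + j)
    <= turan_cliques k.+1 u.+1 x + j * turan_cliques k u (turan_deg k.+1 b).
Proof.
elim: j => [|j IH] xj; first by rewrite addn0 leq_addr.
rewrite addnS turan_cliquesS; have := IH (ltac:(lia)).
have := turan_cliques_mono k u (turan_deg_mono k.+1 (ltac:(lia) : x + j <= b)).
lia.
Qed.

(** Convexity: the increments count the cliques of a Turan graph that grows. *)
Lemma turan_cliques_convex k u x y j : x <= y ->
  turan_cliques k.+1 u.+1 (x + j) + turan_cliques k.+1 u.+1 y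
    <= turan_cliques k.+1 u.+1 x + turan_cliques k.+1 u.+1 (y + j).
Proof.
move=> xy; elim: j => [|j IH]; first by rewrite !addn0.
rewrite !addnS !turan_cliquesS.
have := turan_cliques_mono k u (turan_deg_mono k.+1 (ltac:(lia) : x + j <= y + j)).
lia.
Qed.

(** * The optimisation problem *)

(** Some colex Turan graph with k + 1 classes and at most e edges has at least
    v cliques of size t + 1. The full degree is allowed for c, and the edge
    count is an inequality, so that edges may be dropped on the way. *)
Definition colex_dominated (k t e v : nat) : Prop :=
  exists N c, [/\ c <= turan_deg k.+1 N, turan_cliques k.+1 2 N + c <= e &
                  v <= turan_cliques k.+1 t.+1 N + turan_cliques k t c].

Lemma colex_dominated_le k t e e' v v' :
  e' <= e -> v <= v' -> colex_dominated k t e' v' -> colex_dominated k t e v.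
Proof.
move=> ee' vv' [N [c [cN Ne v'N]]]; exists N, c.
by split=> //; [exact: leq_trans ee' | exact: leq_trans v'N].
Qed.

(** Two vertices of degree at most y can exchange edges until one of them has
    degree y or 0; by convexity this does not decrease the clique count. *)
Lemma stack_normal k u y (ds : seq nat) : all (leq^~ y) ds ->
  exists b d, [/\ d <= y, b * y + d = \sum_(x <- ds) x &
    \sum_(x <- ds) turan_cliques k.+1 u.+1 x
      <= b * turan_cliques k.+1 u.+1 y + turan_cliques k.+1 u.+1 d].
Proof.
elim: ds => [_|x ds IH /= /andP[xy /IH[b [d [dy eb le_b]]]]].
  by exists 0, 0; rewrite !big_nil.
rewrite !big_cons; have [xdy|xdy] := leqP (x + d) y.
  exists b, (x + d); split=> //; first by rewrite -eb; lia.
  have := turan_cliques_convex k u d (leq0n x).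
  by rewrite turan_cliques_n0 add0n; lia.
exists b.+1, (x + d - y); split; [lia|rewrite -eb; lia|].
have := turan_cliques_convex k u (y - d) (ltac:(lia) : x + d - y <= d).
rewrite subnKC // (_ : x + d - y + (y - d) = x) ?mulSn; lia.
Qed.

(** T_{k+2}(y) with a further class of b complete vertices and one vertex of
    degree d, where this class is at most as large as a smallest class of
    T_{k+2}(y). If b is also at least the size of a smallest class of
    T_{k+2}(y - 1), the shape is already colex. Otherwise the last vertex of
    T_{k+2}(y) is moved to the further class. *)
Lemma stack_dominated_few k u y b d : d <= y -> b <= y %/ k.+2 ->
  colex_dominated k.+2 u.+1 (turan_cliques k.+2 2 y + (b * y + d))
    (turan_cliques k.+2 u.+2 y
     + (b * turan_cliques k.+2 u.+1 y + turan_cliques k.+2 u.+1 d)).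
Proof.
elim: y b d => [|y IH] b d dy.
  rewrite div0n leqn0 => /eqP->; exists 0, 0.
  have -> : d = 0 by lia.
  by rewrite !turan_cliques_n0 /turan_deg.
have [qb bq|bq _] := leqP (y %/ k.+2) b.
  have bk := leq_mul bq (leqnn k.+2).
  have := leq_trunc_div y.+1 k.+2; have := ltn_ceil y (ltn0Sn k.+1).
  have := leq_mul qb (leqnn k.+2) => qbk yq yk.
  have bE : (y.+1 + b) %/ k.+3 = b.
    apply/eqP; rewrite eqn_leq -ltnS ltn_divLR // leq_divRL //; lia.
  have dE : turan_deg k.+3 (y.+1 + b) = y.+1 by rewrite /turan_deg bE addnK.
  exists (y.+1 + b), d; rewrite !(turan_cliques_class k.+2) dE bE.
  by rewrite turan_cliques1 //; split=> //; lia.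
have := turan_deg_le k.+2 y; set a := turan_deg k.+2 y => a_le.
have aE : a + y %/ k.+2 = y := turan_degK _ _.
move: bq aE; set q := y %/ _ => bq aE.
have gy : turan_cliques k.+2 u.+1 y =
  turan_cliques k.+1 u.+1 a + q * turan_cliques k.+1 u a.
  by rewrite turan_cliques_class.
rewrite turan_edgesS !turan_cliquesS -/a.
(* The moved vertex gains q edges and loses b. The surplus q - b is taken from
   the vertex of degree d; if d is too small for that, the moved vertex stays
   incomplete and absorbs what the vertex of degree d has. *)
have [qd|dq] := leqP (q - b) d.
  have {IH} := IH b.+1 (d - (q - b)); case; [lia|by []|].
  move=> N [c [cN Ne le_v]]; exists N, c; split=> //; first by lia.
  apply: leq_trans le_v.
  have := turan_cliques_add_le k.+1 u
    (ltac:(lia) : d - (q - b) + (q - b) <= y.+1).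
  rewrite -/a subnK // mulnBl gy; lia.
have {IH} := IH b (d + y - (q - b)); case; [lia|exact: ltnW|].
move=> N [c [cN Ne le_v]]; exists N, c; split=> //; first by lia.
apply: leq_trans le_v.
have := turan_cliques_add_le k.+1 u
  (ltac:(lia) : d + y - (q - b) + (q - b - d) <= y.+1).
have := turan_cliques_add_le k.+1 u (ltac:(lia) : 0 + d <= y.+1).
rewrite turan_cliques_n0 -/a !add0n (_ : d + y - (q - b) + (q - b - d) = y); last by lia.
have qE : q * turan_cliques k.+1 u a = b * turan_cliques k.+1 u a +
    (d * turan_cliques k.+1 u a + (q - b - d) * turan_cliques k.+1 u a).
  by rewrite -!mulnDl; congr (_ * _); lia.
rewrite mulnDr; lia.
Qed.

Lemma big_nseq_addn n y (f : nat -> nat) : \sum_(x <- nseq n y) f x = n * f y.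
Proof. by rewrite big_nseq iter_addn_0 mulnC. Qed.

(** The class is too large when b exceeds q, the size of a smallest class of
    T_{k+2}(y). One of its complete vertices then moves to T_{k+2}(y), where it
    loses q edges and can gain b - 1. These edges come from the vertex of degree
    d; if there are not enough of them, only some of the remaining vertices of
    the class are joined to the moved one. The induction is on the number of
    edges at the class, which drops by the positive number turan_deg (k+2) y. *)
Lemma stack_dominated k u y (ds : seq nat) : all (leq^~ y) ds ->
  colex_dominated k.+2 u.+1 (turan_cliques k.+2 2 y + \sum_(x <- ds) x)
    (turan_cliques k.+2 u.+2 y + \sum_(x <- ds) turan_cliques k.+2 u.+1 x).
Proof.
move sE : (\sum_(x <- ds) x) => s; elim/ltn_ind: s y ds sE => s IH y ds sE.
case/(@stack_normal k.+1 u) => b [d [dy]]; rewrite sE => bd le_s.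
apply: (colex_dominated_le (leqnn _) (v' := turan_cliques k.+2 u.+2 y
     + (b * turan_cliques k.+2 u.+1 y + turan_cliques k.+2 u.+1 d))).
  by rewrite leq_add2l.
rewrite -bd; have [bq|bq] := leqP b (y %/ k.+2); first exact: stack_dominated_few.
case: (posnP y) => [y0|y0].
  rewrite {}y0 leqn0 in dy *; rewrite (eqP dy) !turan_cliques_n0 !muln0.
  by exists 0, 0; rewrite !turan_cliques_n0.
have := turan_deg_gt0 k y0; set a := turan_deg k.+2 y => a0.
have aE : a + y %/ k.+2 = y := turan_degK _ _.
move: bq aE; set q := y %/ _ => bq aE.
have gy : turan_cliques k.+2 u.+1 y =
  turan_cliques k.+1 u.+1 a + q * turan_cliques k.+1 u a.
  by rewrite turan_cliques_class.
case: b bq bd {le_s} => // b; rewrite ltnS => bq; rewrite !mulSn => bd.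
have [qdb|bqd] := leqP (q + d) b.
  have := IH (s - a) _ y.+1 (nseq (q + d) y.+1 ++ nseq (b - (q + d)) y).
  rewrite !big_cat /= !big_nseq_addn all_cat !all_nseq leqnn leqnSn !orbT.
  case=> //; [lia| |].
    have : b * y = (q + d) * y + (b - (q + d)) * y.
      by rewrite -mulnDl subnKC.
    by rewrite mulnS; lia.
  move=> N [c [cN Ne le_v]]; exists N, c; split=> //.
    by apply: leq_trans Ne _; rewrite turan_edgesS -/a; lia.
  apply: leq_trans le_v; rewrite !turan_cliquesS -/a.
  have := turan_cliques_add_le k.+1 u (ltac:(lia) : 0 + d <= y.+1).
  rewrite turan_cliques_n0 -/a !add0n mulnDr !mulnDl.
  have : b * turan_cliques k.+2 u.+1 y = q * turan_cliques k.+2 u.+1 y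
    + d * turan_cliques k.+2 u.+1 y + (b - (q + d)) * turan_cliques k.+2 u.+1 y.
    by rewrite -!mulnDl subnKC.
  lia.
have := IH (s - a) _ y.+1 ((q + d - b) :: nseq b y.+1).
rewrite /= !big_cons !big_nseq_addn all_nseq leqnn orbT andbT.
case=> //; [lia|rewrite mulnS; lia|lia|].
move=> N [c [cN Ne le_v]]; exists N, c; split=> //.
  by apply: leq_trans Ne _; rewrite turan_edgesS -/a; lia.
apply: leq_trans le_v; rewrite !turan_cliquesS -/a.
have := turan_cliques_add_le k.+1 u
  (ltac:(lia) : q + d - b + (b - q) <= y.+1).
rewrite -/a (_ : q + d - b + (b - q) = d); last by lia.
have : b * turan_cliques k.+1 u a = q * turan_cliques k.+1 u a
    + (b - q) * turan_cliques k.+1 u a by rewrite -mulnDl subnKC.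
rewrite mulnDr; lia.
Qed.

(** Here the base graph has a vertex w of degree z < a = turan_deg (k+2) y on
    top of T_{k+2}(y). The vertices of the class with degree beyond y, b in
    number, are adjacent to w as well. If b <= q = y / (k+2), then w has degree
    z + b <= y and can count as one more vertex of the class. Otherwise w is
    completed to degree a inside the base graph, at the expense of one of the b
    vertices, whose degree drops from y + 1 to y + 1 - (a - z) = z + q + 1.
    Both steps use [turan_join_le], on the join of T_{k+1}(z) with b or q + 1
    vertices. *)
Lemma link_dominated k u y z (ds : seq nat) : z < turan_deg k.+2 y ->
  colex_dominated k.+2 u.+1 (turan_cliques k.+2 2 y + z + \sum_(d <- ds) d)
    (turan_cliques k.+2 u.+2 y + turan_cliques k.+1 u.+1 z +
     \sum_(d <- ds) minn (turan_cliques k.+2 u.+1 y + turan_cliques k.+1 u z)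
                         (turan_cliques k.+2 u.+1 d)).
Proof.
set F := turan_cliques k.+2 u.+1 y + turan_cliques k.+1 u z => z_lt.
pose small := [seq d <- ds | d <= y]; pose b := count (ltn y) ds.
have small_le : all (leq^~ y) small by apply/allP=> d; rewrite mem_filter => /andP[].
have sum_ge : b * y.+1 + \sum_(d <- small) d <= \sum_(d <- ds) d.
  rewrite /b /small; elim: (ds) => [|d s IH] /=; first by rewrite !big_nil.
  by case: (ltnP y d) => yd /=; rewrite ?mulSn !big_cons; lia.
have min_le : \sum_(d <- ds) minn F (turan_cliques k.+2 u.+1 d)
    <= b * F + \sum_(d <- small) turan_cliques k.+2 u.+1 d.
  rewrite /b /small; elim: (ds) => [|d s IH] /=; first by rewrite !big_nil.
  by case: (ltnP y d) => yd /=; rewrite ?mulSn !big_cons; lia.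
move: z_lt; set a := turan_deg k.+2 y => za.
have aE : a + y %/ k.+2 = y := turan_degK _ _.
move: aE; set q := y %/ _ => aE.
have gy : turan_cliques k.+2 u.+1 y =
  turan_cliques k.+1 u.+1 a + q * turan_cliques k.+1 u a.
  by rewrite turan_cliques_class.
rewrite {2}/F mulnDr in min_le; rewrite mulnS in sum_ge.
have [bq|qb] := leqP b q.
  have := @stack_dominated k u y ((z + b) :: nseq b y ++ small).
  rewrite /= !big_cons !big_cat /= !big_nseq_addn all_cat all_nseq leqnn orbT small_le.
  case=> [|N [c [cN Ne le_v]]]; first by rewrite andbT; lia.
  exists N, c; split=> //; first by lia.
  by apply: leq_trans le_v; have := turan_join_le k.+1 u z b; lia.
case: b qb sum_ge min_le => // b; rewrite ltnS => qb sum_ge min_le.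
have := @stack_dominated k u y.+1 ((z + q.+1) :: nseq b y.+1 ++ small).
rewrite /= !big_cons !big_cat /= !big_nseq_addn all_cat all_nseq leqnn orbT.
rewrite turan_edgesS -/a !turan_cliquesS -/a.
case=> [|N [c [cN Ne le_v]]].
  apply/andP; split; first by lia.
  by apply: sub_all small_le => d /= dy; exact: leqW.
exists N, c; split=> //; first by rewrite mulnS mulSn in Ne sum_ge *; lia.
apply: leq_trans le_v; have := turan_join_le k.+1 u z q.+1.
have bE x : b * x = q * x + (b - q) * x by rewrite -mulnDl subnKC.
have := leq_mul (leqnn (b - q)) (turan_cliques_mono k.+1 u (ltnW za)).
rewrite mulnDr (bE (turan_cliques k.+1 u a)) !mulSn in min_le *.
rewrite (bE (turan_cliques k.+1 u z)) in min_le; lia.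
Qed.

(** The representation e = e(T_{k+2}(N)) + c is unique only if c is required to
    be strictly below the degree, whence the two different hypotheses on c' and
    c. *)
Lemma colex_value_le k u N c N' c' :
  c' <= turan_deg k.+2 N' -> c < turan_deg k.+2 N ->
  turan_cliques k.+2 2 N' + c' <= turan_cliques k.+2 2 N + c ->
  turan_cliques k.+2 u.+1 N' + turan_cliques k.+1 u c'
    <= turan_cliques k.+2 u.+1 N + turan_cliques k.+1 u c.
Proof.
move=> c'N' cN le_e; case: (ltngtP N' N) => NN.
- have := turan_cliques_mono k.+2 u.+1 NN; rewrite turan_cliquesS.
  have := turan_cliques_mono k.+1 u c'N'; lia.
- have := turan_cliques_mono k.+2 2 NN; rewrite turan_edgesS; lia.
- by rewrite NN leq_add2l turan_cliques_mono //; rewrite NN leq_add2l in le_e.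
Qed.

Lemma colex_decomposition k e :
  exists N c, c < turan_deg k.+2 N /\ e = turan_cliques k.+2 2 N + c.
Proof.
elim: e => [|e [N [c [cN ->]]]].
  by exists 1, 0; rewrite turan_edgesS turan_cliques_n0 turan_deg_gt0.
have [cN'|Nc] := ltnP c.+1 (turan_deg k.+2 N); first by exists N, c.+1; rewrite addnS.
exists N.+1, 0; rewrite turan_deg_gt0 // turan_edgesS.
by split=> //; lia.
Qed.

(** * Cliques of a relation inside a set *)

(** Stated for a relation on a finite type and a set of vertices, so that
    induced subgraphs need no type of their own. *)
Definition is_clique (T : finType) (e : rel T) (S : {set T}) : bool :=
  [forall x in S, forall y in S, (x != y) ==> e x y].

Lemma is_cliqueP (T : finType) (e : rel T) (S : {set T}) :
  reflect {in S &, forall x y, x != y -> e x y} (is_clique e S).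
Proof.
apply: (iffP forall_inP) => [cS x y xS yS|cS x xS].
  by move/forall_inP/(_ y yS)/implyP: (cS x xS).
by apply/forall_inP => y yS; apply/implyP; exact: cS.
Qed.

Definition cliques_in (T : finType) (e : rel T) (X : {set T}) (t : nat) : nat :=
  #|[set S : {set T} | [&& S \subset X, #|S| == t & is_clique e S]]|.

Lemma cliques_in_sub (T : finType) (e e' : rel T) (X X' : {set T}) t :
  X \subset X' -> {in X &, subrel e e'} -> cliques_in e X t <= cliques_in e' X' t.
Proof.
move=> XX' ee'; apply/subset_leq_card/subsetP => S; rewrite !inE.
case/and3P=> SX -> /is_cliqueP cS; rewrite (subset_trans SX XX') /=.
apply/is_cliqueP => x y xS yS /(cS x y xS yS).
by apply: ee'; apply: (subsetP SX).
Qed.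

Lemma cliques_in0 (T : finType) (e : rel T) (X : {set T}) : cliques_in e X 0 = 1.
Proof.
rewrite /cliques_in (_ : [set _ | _] = [set set0]) ?cards1 //.
apply/setP => S; rewrite !inE cards_eq0; case: eqP => [->|//]; last by rewrite andbF.
by rewrite sub0set; apply/is_cliqueP => x y; rewrite inE.
Qed.

Lemma cliques_in_set0 (T : finType) (e : rel T) t : cliques_in e set0 t = (t == 0).
Proof.
case: t => [|t]; first by rewrite cliques_in0.
apply/eqP; rewrite cards_eq0; apply/eqP/setP => S; rewrite !inE subset0.
by case: eqP => // ->; rewrite cards0.
Qed.

Definition nbrs (T : finType) (e : rel T) (v : T) : {set T} := [set w | e v w].

(** The cliques that contain v are the cliques of its neighbourhood. *)
Lemma cliques_inD1 (T : finType) (e : rel T) (X : {set T}) (v : T) t :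
  symmetric e -> irreflexive e -> v \in X ->
  cliques_in e X t.+1 = cliques_in e (X :\ v) t.+1 + cliques_in e (X :&: nbrs e v) t.
Proof.
move=> esym eirr vX.
rewrite {1}/cliques_in -(cardsID [set S : {set T} | v \in S]) addnC; congr (_ + _).
  apply: eq_card => S; rewrite !inE subsetD1.
  by case: (v \in S); rewrite ?andbF ?andbT.
rewrite /cliques_in -[RHS](card_in_imset (f := fun S => v |: S)); last first.
  move=> S S'; rewrite !inE !subsetI => /andP[/andP[_ Sv] _] /andP[/andP[_ Sv'] _] dS.
  have vN (Y : {set T}) : Y \subset nbrs e v -> v \notin Y.
    by move=> Yv; apply/negP => /(subsetP Yv); rewrite inE eirr.
  by rewrite -(setU1K (vN S Sv)) dS setU1K // vN.
apply: eq_card => S; rewrite !inE; apply/andP/imsetP => [[/and3P[SX cS kS] vS]|].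
  exists (S :\ v); last by rewrite setD1K.
  move: cS; rewrite (cardsD1 v) vS add1n eqSS !inE => ->.
  move/is_cliqueP: kS => kS; rewrite subsetI (subset_trans (subsetDl _ _) SX) /=.
  apply/andP; split.
    apply/subsetP => w; rewrite !inE => /andP[wv wS].
    by apply: kS; rewrite // eq_sym.
  by apply/is_cliqueP => x y; rewrite !inE => /andP[_ xS] /andP[_ yS]; exact: kS.
case=> S'; rewrite !inE subsetI -andbA => /and4P[SX /subsetP Sv cS /is_cliqueP kS] ->.
have vS : v \notin S' by apply/negP => /Sv; rewrite inE eirr.
rewrite cardsU1 vS add1n eqSS cS setU11 subUset sub1set vX SX /=.
split=> //; apply/is_cliqueP => x y; rewrite !inE.
case/predU1P=> [->|xS] /predU1P[->|yS]; rewrite ?eqxx // => xy.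
- by have := Sv y yS; rewrite inE.
- by have := Sv x xS; rewrite inE esym.
- exact: kS.
Qed.

Lemma cliques_in1 (T : finType) (e : rel T) (X : {set T}) :
  symmetric e -> irreflexive e -> cliques_in e X 1 = #|X|.
Proof.
move=> es ei; move dn : #|X| => n; elim: n X dn => [|n IH] X dn.
  by rewrite (cards0_eq dn) cliques_in_set0.
have /set0Pn[v vX] : X != set0 by rewrite -cards_eq0 dn.
rewrite (cliques_inD1 0 es ei vX) cliques_in0 IH ?addn1 //.
by move: dn; rewrite (cardsD1 v) vX => -[].
Qed.

(** Deleting the vertices of Y outside N one at a time: Ls lists the
    neighbourhoods that they have at their deletion. The list is independent of
    t, so that the same neighbourhoods account for edges (t = 1) and for larger
    cliques. *)
Lemma cliques_in_delete (T : finType) (e : rel T) (X N Y : {set T}) :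
  symmetric e -> irreflexive e -> N \subset Y -> Y \subset X ->
  exists Ls : seq {set T},
   [/\ size Ls = #|Y :\: N|,
       forall L, L \in Ls -> exists2 v, v \in X & L \subset X :&: nbrs e v &
       forall t, cliques_in e Y t.+1 =
         cliques_in e N t.+1 + \sum_(L <- Ls) cliques_in e L t].
Proof.
move=> es ei; move dn : #|Y :\: N| => n; elim: n Y dn => [|n IH] Y dn NY YX.
  have -> : N = Y.
    by apply/eqP; rewrite eqEsubset NY /= -setD_eq0 -cards_eq0 dn.
  by exists [::]; split=> // t; rewrite big_nil addn0.
have /set0Pn[v] : Y :\: N != set0 by rewrite -cards_eq0 dn.
rewrite inE => /andP[vN vY].
have [] := IH (Y :\ v).
- move: dn; rewrite (cardsD1 v) inE vN vY => -[<-].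
  by apply: eq_card => w; rewrite !inE andbCA.
- by rewrite subsetD1 NY.
- exact: subset_trans (subsetDl _ _) YX.
move=> Ls [sz sub dec]; exists ((Y :&: nbrs e v) :: Ls); split=> [|L|t].
- by rewrite /= sz.
- rewrite inE => /predU1P[->|/sub//]; exists v; first exact: (subsetP YX).
  exact: setSI.
- by rewrite (cliques_inD1 t es ei vY) dec big_cons addnAC addnA.
Qed.

Lemma cliques_in_link_free (T : finType) (e : rel T) (X L : {set T}) (v : T) s :
  symmetric e -> irreflexive e -> cliques_in e X s.+1 = 0 ->
  v \in X -> L \subset X :&: nbrs e v -> cliques_in e L s = 0.
Proof.
move=> es ei; move=> X0 vX LX; apply/eqP; rewrite -leqn0.
apply: leq_trans (cliques_in_sub (e' := e) s LX _) _ => //.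
by rewrite -X0 (cliques_inD1 s es ei vX) leq_addl.
Qed.

Lemma cliques_in_max_link (T : finType) (e : rel T) (X : {set T}) t : X != set0 ->
  exists2 v, v \in X & forall w (L : {set T}), w \in X -> L \subset X :&: nbrs e w ->
    cliques_in e L t <= cliques_in e (X :&: nbrs e v) t.
Proof.
case/set0Pn => x xX.
case: (arg_maxnP (fun w => cliques_in e (X :&: nbrs e w) t) xX) => v vX v_max.
exists v => // w L wX LX; apply: leq_trans (v_max w wX).
exact: cliques_in_sub.
Qed.

(** Zykov's theorem. With v as in [cliques_in_max_link] and A the neighbourhood
    of v, each deleted vertex creates at most as many cliques as A contains, so
    the count is at most that of the join of A with an independent set, and
    [turan_join_le] finishes the induction. *)
Lemma cliques_in_le_turan (T : finType) (e : rel T) r (X : {set T}) t :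
  symmetric e -> irreflexive e -> cliques_in e X r.+1 = 0 ->
  cliques_in e X t <= turan_cliques r t #|X|.
Proof.
move=> es ei; elim: r X t => [|r IH] X t X0.
  have /cards0_eq-> : #|X| = 0 by rewrite -(cliques_in1 X es ei).
  by rewrite cliques_in_set0 turan_cliques_no_class.
case: t => [|t]; first by rewrite cliques_in0 turan_cliques0.
have [->|nX] := eqVneq X set0; first by rewrite cliques_in_set0.
have [v vX v_max] := cliques_in_max_link e t nX.
have [Ls [sz sub ->]] := cliques_in_delete es ei (subsetIl X (nbrs e v)) (subxx X).
set N := X :&: _ in v_max sz *.
have N0 : cliques_in e N r.+1 = 0 by apply: cliques_in_link_free X0 vX _.
have -> : #|X| = #|N| + size Ls by rewrite sz -(cardsID N X) (setIidPr _) ?subsetIl.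
apply: leq_trans (turan_join_le r t #|N| (size Ls)).
apply: leq_add; first exact: IH.
rewrite -sum1_size big_distrl /= big_seq [leqRHS]big_seq.
apply: leq_sum => L /sub[w wX LX]; rewrite mul1n.
exact: leq_trans (v_max w L wX LX) (IH _ _ N0).
Qed.

(** The induction hypothesis is used for A both with t and with t - 1, at the
    same decomposition of the number of edges of A. Zykov's bound alone would be
    too weak for the deleted vertices when A has few edges. *)
Lemma cliques_in_le_colex (T : finType) (e : rel T) r (X : {set T}) t N c :
  symmetric e -> irreflexive e -> cliques_in e X r.+3 = 0 ->
  c < turan_deg r.+2 N -> cliques_in e X 2 <= turan_cliques r.+2 2 N + c ->
  cliques_in e X t.+2 <= turan_cliques r.+2 t.+2 N + turan_cliques r.+1 t.+1 c.
Proof.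
move=> es ei; elim: r X t N c => [|r IH] X [|u] N c X0 cN le_e.
- by rewrite turan_cliques1.
- apply: leq_trans (cliques_in_le_turan _ es ei X0) _.
  by rewrite turan_cliques_small.
- by rewrite turan_cliques1.
have [->|nX] := eqVneq X set0; first by rewrite cliques_in_set0.
have [v vX v_max] := cliques_in_max_link e u.+2 nX.
have [Ls [_ sub dec]] := cliques_in_delete es ei (subsetIl X (nbrs e v)) (subxx X).
move: v_max dec; set A := X :&: _ => v_max dec.
have A0 : cliques_in e A r.+3 = 0 by apply: cliques_in_link_free X0 vX _.
have [y [z [zy eA]]] := colex_decomposition r (cliques_in e A 2).
have le_A t := IH A t y z A0 zy (eq_leq eA).
have [N' [c' [cN' le_e' le_v]]] := link_dominated u.+1 [seq #|L| | L : {set T} <- Ls] zy.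
apply: leq_trans (colex_value_le u.+2 cN' cN (leq_trans le_e' _)).
  apply: leq_trans le_v; rewrite dec !big_map; apply: leq_add; first exact: le_A.
  rewrite big_seq [leqRHS]big_seq; apply: leq_sum => L /sub[w wX LX].
  rewrite leq_min (leq_trans (v_max w L wX LX) (le_A u)) /=.
  apply: cliques_in_le_turan => //; exact: cliques_in_link_free X0 wX LX.
apply: leq_trans le_e; rewrite dec -eA big_map leq_add2l leq_sum // => L _.
by rewrite cliques_in1.
Qed.

(** * Complete multipartite graphs *)

Lemma cliques_in_class (T : finType) (e : rel T) (X C : {set T}) t :
  symmetric e -> irreflexive e -> C \subset X ->
  {in C &, forall x y, ~~ e x y} ->
  {in C & X :\: C, forall x y, e x y} ->
  cliques_in e X t.+1 =
  cliques_in e (X :\: C) t.+1 + #|C| * cliques_in e (X :\: C) t.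
Proof.
move=> es ei; move dn : #|C| => n; elim: n X C dn => [|n IH] X C dn CX indep join.
  by rewrite (cards0_eq dn) setD0 addn0.
have /set0Pn[v vC] : C != set0 by rewrite -cards_eq0 dn.
have vX := subsetP CX v vC; rewrite (cliques_inD1 t es ei vX).
have DE : (X :\ v) :\: (C :\ v) = X :\: C.
  by apply/setP => w; rewrite !inE; case: (eqVneq w v) => [->|//]; rewrite vC.
have -> : X :&: nbrs e v = X :\: C.
  apply/setP => w; rewrite !inE andbC; have [wC|wC] := boolP (w \in C).
    by rewrite (negPf (indep v w vC wC)).
  have [wX|//] := boolP (w \in X); last by rewrite andbF.
  by rewrite join // inE wC.
rewrite (IH _ (C :\ v)) ?DE ?mulSn; first lia.
- by move: dn; rewrite (cardsD1 v) vC => -[].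
- exact: setSD.
- by move=> x y /setD1P[_ xC] /setD1P[_ yC]; exact: indep.
- by move=> x y /setD1P[_ xC]; exact: join.
Qed.

(** Complete multipartite graphs with class sizes q and q + 1 are Turan graphs:
    remove a class of size |X| / #|K|, which is q unless all of the classes
    have q + 1 vertices. *)
Lemma cliques_in_balanced (T J : finType) (f : T -> J) (K : {set J}) (X : {set T}) q t :
  {in X, forall x, f x \in K} ->
  {in K, forall j, q <= #|[set x in X | f x == j]| <= q.+1} ->
  cliques_in (fun x y => f x != f y) X t = turan_cliques #|K| t #|X|.
Proof.
move dk : #|K| => k; elim: k K X t dk => [|k IH] K X t dk fK bal.
  have -> : X = set0.
    by apply/setP => x; rewrite inE; apply/negP => /fK; rewrite (cards0_eq dk) inE.
  by rewrite cliques_in_set0 turan_cliques_no_class.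
case: t => [|t]; first by rewrite cliques_in0 turan_cliques0.
pose cls j := [set x in X | f x == j].
have {}bal : {in K, forall j, q <= #|cls j| <= q.+1} := bal.
have XE : #|X| = \sum_(j in K) #|cls j|.
  rewrite -sum1_card (partition_big f (mem K)) //=; apply: eq_bigr => j _.
  by rewrite -sum1_card; apply: eq_bigl => x; rewrite !inE.
have [j jK jE] : exists2 j, j \in K & #|cls j| = #|X| %/ k.+1.
  have [/exists_inP[j jK /eqP jq]|/exists_inPn big] :=
    boolP [exists j in K, #|cls j| == q].
    exists j => //; apply/eqP; rewrite jq eq_sym eqn_leq -ltnS ltn_divLR // leq_divRL //.
    rewrite XE; apply/andP; split.
      rewrite (bigD1 j) //= jq; have : \sum_(i in K | i != j) #|cls i| <= k * q.+1.
        rewrite -[k]/(k.+1.-1) -dk (cardsD1 j) jK /= -sum_nat_const.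
        rewrite [leqRHS](eq_bigl (fun i => (i \in K) && (i != j))); last first.
          by move=> i; rewrite !inE andbC.
        by apply: leq_sum => i /andP[iK _]; have /andP[] := bal i iK.
      by lia.
    rewrite mulnC -dk -sum_nat_const; apply: leq_sum => i iK.
    by have /andP[] := bal i iK.
  have /set0Pn[j jK] : K != set0 by rewrite -cards_eq0 dk.
  have clsE i : i \in K -> #|cls i| = q.+1.
    by move=> iK; apply/eqP; rewrite eqn_leq; have := big i iK; have := bal i iK; lia.
  exists j => //; rewrite clsE // XE (eq_bigr (fun=> q.+1) clsE) sum_nat_const dk.
  by rewrite mulKn.
have cX : cls j \subset X by apply/subsetP => x; rewrite inE => /andP[].
rewrite (@cliques_in_class _ _ _ (cls j)) //.
- have restE s : cliques_in (fun x y => f x != f y) (X :\: cls j) s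
      = turan_cliques k s #|X :\: cls j|.
    apply: (IH (K :\ j)).
    + by move: dk; rewrite (cardsD1 j) jK => -[].
    + by move=> x; rewrite !inE => /andP[]; have [xX|//] := boolP (x \in X); rewrite fK ?andbT.
    + move=> i /setD1P[ij iK]; have := bal i iK; congr (_ <= _ <= _); apply: eq_card => x;
      by rewrite !inE; case: (eqVneq (f x) i) => [->|]; rewrite ?andbF // (negPf ij) !andbT ?andbF.
  rewrite !restE; have -> : #|X :\: cls j| = turan_deg k.+1 #|X|.
    by rewrite cardsD (setIidPr cX) jE.
  by rewrite jE turan_cliques_class.
- by move=> x y; rewrite eq_sym.
- by move=> x; rewrite eqxx.
- by move=> x y; rewrite !inE negbK => /andP[_ /eqP->] /andP[_ /eqP->].
- move=> x y; rewrite !inE => /andP[_ /eqP->] /andP[]; have [yX|//] := boolP (y \in X).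
  by rewrite eq_sym.
Qed.

Lemma card_ord_prefix n m (p : pred nat) : m <= n ->
  #|[set x : 'I_n | (x < m) && p x]| = count p (iota 0 m).
Proof.
move=> mn; have -> : count p (iota 0 m) = \sum_(i < m | p i) 1.
  by rewrite -(big_mkord p (fun=> 1)) /index_iota subn0 sum1_count.
rewrite -sum1_card (@big_ord_widen_cond _ _ _ m n p (fun=> 1)) //.
by apply: eq_bigl => x; rewrite inE andbC.
Qed.

Lemma count_residue r j n : j < r ->
  count (fun i => i %% r == j) (iota 0 n) = n %/ r + (j < n %% r).
Proof.
case: r => // r jr; elim: n => [|n IH]; first by rewrite div0n mod0n.
rewrite -{1}(addn1 n) iotaD count_cat IH /= add0n addn0.
have := divn_eq n r.+1; have := ltn_pmod n (ltn0Sn r).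
move: (n %/ r.+1) (n %% r.+1) => q s; rewrite ltnS leq_eqVlt.
case/orP=> [/eqP->|sr] ->.
  have -> : (q * r.+1 + r).+1 = q.+1 * r.+1 by lia.
  by rewrite mulnK // modnMl; lia.
have -> : (q * r.+1 + s).+1 = q * r.+1 + s.+1 by lia.
by rewrite divnMDl // modnMDl (divn_small (m := s.+1)) ?(modn_small (m := s.+1)) ?ltnS //; lia.
Qed.

(** * The colex order and the edges of the colex Turan graph *)

Definition cross_count (r j n : nat) : nat := count (fun i => i != j %[mod r]) (iota 0 n).

Lemma cross_count_self r n : 0 < r -> cross_count r n n = turan_deg r n.
Proof.
move=> r0; have := count_predC (fun i => i %% r == n %% r) (iota 0 n).
rewrite size_iota count_residue ?ltn_pmod // ltnn addn0 /turan_deg => nE.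
by apply: (@addnI (n %/ r)); rewrite subnKC ?leq_div.
Qed.

Lemma cross_countS r j n : cross_count r j n.+1 = cross_count r j n + (n != j %[mod r]).
Proof. by rewrite /cross_count -(addn1 n) iotaD count_cat /= addn0. Qed.

Lemma cross_count_mono r j : {homo cross_count r j : m n / m <= n}.
Proof.
apply: homo_leq => [//|m n p|n]; first exact: leq_trans.
by rewrite cross_countS leq_addr.
Qed.

Lemma cross_count_lt r j i n : i < n -> i != j %[mod r] ->
  cross_count r j i < cross_count r j n.
Proof.
move=> i_n ij; apply: leq_trans (cross_count_mono r j i_n).
by rewrite cross_countS ij addn1.
Qed.

(** The first c vertices outside the class of j are those below some bound m,
    hence form the vertex set of a Turan graph. *)
Lemma cross_count_ivt r j n c : c <= cross_count r j n ->
  exists2 m, m <= n & cross_count r j m = c.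
Proof.
elim: n => [|n IH]; first by rewrite leqn0 => /eqP->; exists 0.
have [/IH[m mn <-] _|nc] := leqP c (cross_count r j n); first by exists m; rewrite // leqW.
by move=> cn; exists n.+1 => //; apply/eqP; rewrite eqn_leq cn andbT cross_countS; lia.
Qed.

Lemma bigmax_mem (s : seq nat) y : y \in s -> \max_(x <- s) x \in s.
Proof.
elim: s y => // x s IH y _; rewrite big_cons inE.
case: s IH => [|z s] IH; first by rewrite big_nil maxn0 eqxx.
have := IH z (mem_head z s); case: (leqP (\max_(j <- z :: s) j) x) => _ mem.
  by rewrite eqxx.
by rewrite mem orbT.
Qed.

(** A description of the colex order that avoids the maximum of a list. *)
Lemma colex_ltP (A B : {fset nat}) :
  reflect (exists x, [/\ x \in B, x \notin A &
             forall y, y \in A -> y \notin B -> y < x])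
          (colex_lt A B).
Proof.
set D := ((A `\` B) `|` (B `\` A))%fset.
have maxD y : y \in D -> y <= \max_(x <- D) x.
  by move=> yD; apply: (@leq_bigmax_seq _ _ xpredT id).
have inD y : (y \in D) = (y \in A) && (y \notin B) || (y \in B) && (y \notin A).
  by rewrite !inE andbC [_ && (y \in B)]andbC.
rewrite /colex_lt -/D; apply: (iffP andP) => [[AB maxB]|[x [xB xA x_max]]].
  have [D0|[y yD]] := fset_0Vmem D.
    case/eqP: AB; apply/fsetP => y; have := inD y; rewrite D0 inE.
    by case: (y \in A); case: (y \in B).
  have := bigmax_mem yD; rewrite -[_ \in _]/(_ \in D) inD maxB andbF /= => maxA.
  exists (\max_(x <- D) x); split=> // z zA zB.
  have /maxD : z \in D by rewrite inD zA zB.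
  by rewrite leq_eqVlt => /predU1P[dz|//]; rewrite -dz (negPf zB) in maxB.
have xD : x \in D by rewrite inD xB xA orbT.
split; first by apply: contraNneq xA => ->.
have := bigmax_mem xD; rewrite -[_ \in _]/(_ \in D) inD.
case/orP=> /andP[// MA MB]; have := x_max _ MA MB.
by rewrite ltnNge maxD.
Qed.

Lemma colex_lt_pair i j i' j' : i < j -> i' < j' ->
  colex_lt [fset i; j]%fset [fset i'; j']%fset = (j < j') || (j == j') && (i < i').
Proof.
move=> ij ij'; apply/colex_ltP/idP => [[x []]|].
  rewrite !inE => x' x_ y_lt; have := y_lt i; have := y_lt j; rewrite !inE !eqxx ?orbT.
  by move=> /(_ isT) jx /(_ isT) ix; lia.
case/orP=> [jj|/andP[/eqP jj ii]]; last subst j'.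
  exists j'; rewrite !inE eqxx orbT; split=> //; first by lia.
  by move=> y; rewrite !inE; lia.
exists i'; rewrite !inE eqxx; split=> //; first by lia.
by move=> y; rewrite !inE; lia.
Qed.

Lemma colex_le_trans_pairs r n :
  {in turan_pairs r n & &, transitive colex_le}.
Proof.
move=> _ _ _ /turan_pairsP[i2 [j2 [/andP[ij2 _] _ ->]]]
  /turan_pairsP[i1 [j1 [/andP[ij1 _] _ ->]]] /turan_pairsP[i3 [j3 [/andP[ij3 _] _ ->]]].
rewrite /colex_le => /predU1P[->//|lt12] /predU1P[<-|]; first by rewrite lt12 orbT.
by move: lt12; rewrite !colex_lt_pair // => lt12 lt23; apply/orP; right; lia.
Qed.

Definition cross_pairs (r n : nat) : seq (nat * nat) :=
  [seq p <- [seq (i, j) | j <- iota 0 n, i <- iota 0 j] | p.1 != p.2 %[mod r]].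

Definition cross_row (r j : nat) : seq (nat * nat) :=
  [seq (i, j) | i <- iota 0 j & i != j %[mod r]].

Lemma cross_pairsS r n : cross_pairs r n.+1 = cross_pairs r n ++ cross_row r n.
Proof.
rewrite /cross_pairs -addn1 iotaD map_cat flatten_cat filter_cat; congr (_ ++ _).
by rewrite add0n /= cats0 filter_map.
Qed.

Lemma size_cross_pairs r n : size (cross_pairs r.+2 n) = turan_cliques r.+2 2 n.
Proof.
elim: n => [|n IH]; first by rewrite turan_cliques_n0.
rewrite cross_pairsS size_cat IH turan_edgesS size_map size_filter.
by rewrite -/(cross_count r.+2 n n) cross_count_self.
Qed.

Lemma cross_pairsP r n p : p \in cross_pairs r n -> p.1 < p.2 < n.
Proof.
rewrite mem_filter => /andP[_ /allpairsPdep[j [i [jn ij ->]]]] /=.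
by move: jn ij; rewrite !mem_iota /= !add0n => -> ->.
Qed.

Lemma cross_pairs_colex r n :
  pairwise (fun p q => [&& p.1 < p.2, q.1 < q.2 & (p.2 < q.2) || (p.2 == q.2) && (p.1 < q.1)])
    (cross_pairs r n).
Proof.
elim: n => // n IH; rewrite cross_pairsS pairwise_cat IH /=; apply/andP; split.
  apply/allrelP => p q /cross_pairsP/andP[p12 pn] /mapP[i].
  by rewrite mem_filter mem_iota add0n leq0n /= => /andP[_ i_n] -> /=; rewrite p12 i_n pn.

rewrite /cross_row pairwise_map; apply: pairwise_filter.
apply: (@sub_in_pairwise _ (gtn n) ltn).
- by move=> x y; rewrite !unfold_in /= => xn yn xy; rewrite xn yn xy eqxx orbT.
- by apply/allP => x; rewrite mem_iota.
- by rewrite -sorted_pairwise ?iota_ltn_sorted //; exact: ltn_trans.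
Qed.

(** The enumeration by larger, then smaller element is colex increasing, so that
    sorting leaves it unchanged. *)
Lemma colex_turan_edgesE r m :
  colex_turan_edges r m = take m [seq [fset p.1; p.2]%fset | p <- cross_pairs r m.+1].
Proof.
rewrite /colex_turan_edges; congr take.
apply: (sorted_sort_in (@colex_le_trans_pairs r m.+1)); first exact/allP.
apply: pairwise_sorted; rewrite pairwise_map.
apply: sub_pairwise (cross_pairs_colex r m.+1) => p q /and3P[p12 q12 pq].
by rewrite /relpre /= /colex_le colex_lt_pair // pq orbT.
Qed.

(** The sum is the position of {i, j} in the colex order: it counts the pairs
    below j and the pairs {x, j} with x < i. *)
Lemma mem_colex_turan_edges r m i j :
  i < j <= m -> i != j %[mod r.+2] ->
  turan_cliques r.+2 2 j + cross_count r.+2 j i < m ->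
  [fset i; j]%fset \in colex_turan_edges r.+2 m.
Proof.
move=> /andP[ij jm] nij lt_m; rewrite colex_turan_edgesE -map_take.
apply: (map_f (fun p => [fset p.1; p.2]%fset) (x := (i, j))).
have [s2 ->] : exists s2, cross_pairs r.+2 m.+1 = cross_pairs r.+2 j.+1 ++ s2.
  elim: m jm {lt_m} => [|m IH]; first by rewrite leqn0 => /eqP->; exists [::]; rewrite cats0.
  rewrite leq_eqVlt => /predU1P[->|/IH[s2 dm]]; first by exists [::]; rewrite cats0.
  by exists (s2 ++ cross_row r.+2 m.+1); rewrite cross_pairsS dm catA.
rewrite cross_pairsS; have -> : cross_row r.+2 j = [seq (x, j) | x <- iota 0 i & x != j %[mod r.+2]]
    ++ (i, j) :: [seq (x, j) | x <- iota i.+1 (j - i.+1) & x != j %[mod r.+2]].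
  rewrite /cross_row -[in iota 0 j](subnKC (ltnW ij)) iotaD filter_cat map_cat.
  by rewrite add0n -(subnSK ij) /= nij.
rewrite catA -catA cat_cons.
rewrite take_cat size_cat size_cross_pairs size_map size_filter -/(cross_count r.+2 j i).
rewrite ltnNge (ltnW lt_m) /= mem_cat orbC.
by rewrite -(subnSK lt_m) /= mem_head.
Qed.

(** * Cliques of the colex Turan graph and the theorem *)

(** Injectivity on D only: the vertices of CT are a proper subset of an initial
    segment in general, and elsewhere the maps used take a default value. *)
Lemma cliques_in_embed (T T' : finType) (e : rel T) (e' : rel T') (f : T -> T')
    (D : {set T}) t :
  {in D &, injective f} -> {in D &, forall x y, e x y -> e' (f x) (f y)} ->
  cliques_in e D t <= cliques_in e' setT t.
Proof.
move=> f_inj f_hom; rewrite /cliques_in -(card_in_imset (f := fun S : {set T} => f @: S)).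
  apply/subset_leq_card/subsetP => _ /imsetP[S + ->].
  rewrite !inE => /and3P[/subsetP SD cS /is_cliqueP kS].
  rewrite subsetT card_in_imset ?cS; last by move=> x y /SD xD /SD; exact: f_inj.
  apply/is_cliqueP => _ _ /imsetP[x xS ->] /imsetP[y yS ->] fxy.
  by apply: f_hom; rewrite ?SD //; apply: kS => //; apply: contraNneq fxy => ->.
have sub (S S' : {set T}) : S \subset D -> S' \subset D -> f @: S = f @: S' -> S \subset S'.
  move=> /subsetP SD /subsetP SD' dS; apply/subsetP => x xS.
  have /imsetP[y yS /f_inj->] : f x \in f @: S' by rewrite -dS imset_f.
  - by [].
  - exact: SD.
  - exact: SD'.
move=> S S'; rewrite !inE => /and3P[SD _ _] /and3P[SD' _ _] dS.
by apply/eqP; rewrite eqEsubset (sub S S') // (sub S' S).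
Qed.

Lemma num_cliquesE t (G : sgraph) : num_cliques t G = cliques_in (@adj G) setT t.
Proof. by apply: eq_card => S; rewrite !inE subsetT. Qed.

Lemma num_edgesE (G : sgraph) : num_edges G = num_cliques 2 G.
Proof.
apply: eq_card => S; rewrite !inE; apply/existsP/andP => [[x /existsP[y /andP[xy /eqP->]]]|].
  have nxy : x != y by apply: contraTneq xy => ->; rewrite adj_irrefl.
  rewrite cards2 nxy; split=> //; apply/is_cliqueP => u v.
  by rewrite !inE => /orP[]/eqP-> /orP[]/eqP->; rewrite ?eqxx // adj_sym.
case=> /cards2P[x [y [nxy ->]]] /is_cliqueP kS.
by exists x; apply/existsP; exists y; rewrite kS ?inE ?eqxx ?orbT.
Qed.

Lemma clique_free_eq0 s (G : sgraph) : clique_free s G -> num_cliques s G = 0.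
Proof.
move=> free; apply/eqP; rewrite cards_eq0; apply/eqP/setP => S; rewrite !inE.
by apply/negP => /andP[/eqP cS kS]; exact: free kS cS.
Qed.

Lemma isomorphic_num_cliques t (G H : sgraph) :
  isomorphic G H -> num_cliques t G = num_cliques t H.
Proof.
case=> f [g fK gK] fadj; apply/eqP; rewrite !num_cliquesE eqn_leq.
apply/andP; split.
  apply: (cliques_in_embed (f := f)) => [x y _ _|x y _ _]; first exact: (can_inj fK).
  by rewrite fadj.
apply: (cliques_in_embed (f := g)) => [x y _ _|x y _ _]; first exact: (can_inj gK).
by rewrite -fadj !gK.
Qed.

Lemma colex_turan_edges_irrefl r m i : [fset i; i]%fset \notin colex_turan_edges r m.
Proof.
apply/negP => /mem_take; rewrite mem_sort => /turan_pairsP[x [y [/andP[xy _] _ /fsetP E]]].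
by have := E x; have := E y; rewrite !inE !eqxx ?orbT; lia.
Qed.

(** A clique with at least two vertices consists of endpoints of edges, hence of
    vertices of CT. *)
Lemma CT_pullback_le n r m t :
  cliques_in (fun i j : 'I_n => [fset val i; val j]%fset \in colex_turan_edges r m)
    setT t.+2 <= num_cliques t.+2 (CT r m).
Proof.
set e := fun i j => _.
have in_vertices (i j : 'I_n) : e i j -> val i \in colex_turan_vertices r m.
  by move=> eij; apply/bigfcupP; exists [fset val i; val j]%fset; rewrite ?andbT // !inE eqxx.
pose D : {set 'I_n} := [set i | val i \in colex_turan_vertices r m].
have le_D : cliques_in e setT t.+2 <= cliques_in e D t.+2.
  apply/subset_leq_card/subsetP => S; rewrite !inE => /and3P[_ /eqP cS kS].
  rewrite cS eqxx kS !andbT; apply/subsetP => i iS; rewrite inE.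
  have /card_gt0P[j] : 0 < #|S :\ i| by move: cS; rewrite (cardsD1 i) iS add1n => -[->].
  case/setD1P=> ji jS; apply: (in_vertices _ j).
  by apply: (is_cliqueP _ _ kS); rewrite // eq_sym.
apply: leq_trans le_D _; rewrite num_cliquesE.
have [->|[i0]] := set_0Vmem D; first by rewrite cliques_in_set0.
rewrite inE => i0V; pose f (i : 'I_n) : CT r m := insubd (FSetSub i0V) (val i).
have fK i : i \in D -> val (f i) = val i.
  by rewrite inE => iV; rewrite /f val_insubd iV.
apply: (cliques_in_embed (f := f)) => [i j iD jD dij|i j iD jD].
  by apply: val_inj; rewrite -fK // dij fK.
by rewrite /e /= /colex_turan_adj !fK.
Qed.

Lemma cliques_in_residues n m r (K : {set 'I_r.+1}) (p : pred nat) t : m <= n ->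
  (forall i : nat, p i = (Ordinal (ltn_pmod i (ltn0Sn r)) \in K)) ->
  cliques_in (fun i j : 'I_n => i != j %[mod r.+1]) [set i : 'I_n | (i < m) && p i] t
    = turan_cliques #|K| t (count p (iota 0 m)).
Proof.
move=> mn pK; pose f (i : 'I_n) := Ordinal (ltn_pmod i (ltn0Sn r)).
rewrite -(card_ord_prefix p mn).
apply: (@cliques_in_balanced _ _ f K _ (m %/ r.+1)) => [i|j jK].
  by rewrite inE pK => /andP[].
have -> : #|[set i in [set i : 'I_n | (i < m) && p i] | f i == j]|
    = #|[set i : 'I_n | (i < m) && (i %% r.+1 == j)]|.
  apply: eq_card => i; rewrite !inE -andbA pK; congr (_ && _).
  by rewrite -val_eqE andbC; case: eqP => //= dj; rewrite (_ : Ordinal _ = j) //; exact: val_inj.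
by rewrite (card_ord_prefix (fun i => i %% r.+1 == j) mn) count_residue //; case: (_ < _); lia.
Qed.

(** Split the cliques according to whether they contain the vertex N. Those that
    do not are cliques of T_r(N), and the others come from the first c vertices
    outside the class of N, which are balanced over the other classes. *)
Lemma CT_cliques_ge r N c t : c < turan_deg r.+2 N ->
  turan_cliques r.+2 t.+2 N + turan_cliques r.+1 t.+1 c
    <= num_cliques t.+2 (CT r.+2 (turan_cliques r.+2 2 N + c)).
Proof.
move=> cN; set m := _ + c; apply: leq_trans (CT_pullback_le N.+1 r.+2 m t).
have edge i j : i < j -> i != j %[mod r.+2] ->
    (j < N) || (j == N) && (cross_count r.+2 N i < c) ->
    [fset i; j]%fset \in colex_turan_edges r.+2 m.
  move=> ij nij jN.
  have E_ge k : k.-1 <= turan_cliques r.+2 2 k.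
    elim: k => // k IH; rewrite turan_edgesS.
    by case: k IH => // k IH; have := turan_deg_gt0 r (ltn0Sn k); rewrite /= in IH *; lia.
  apply: mem_colex_turan_edges => //.
    by rewrite ij /m; have := E_ge N; lia.
  case/orP: jN => [jN|/andP[/eqP-> ic]]; last by rewrite ltn_add2l.
  have := turan_cliques_mono r.+2 2 jN; rewrite turan_edgesS.
  by have := cross_count_lt ij nij; rewrite cross_count_self // /m; lia.
set e := fun i j => _.
have e_sym : symmetric e by move=> i j; rewrite /e fsetUC.
have e_irr : irreflexive e by move=> i; apply: negbTE; exact: colex_turan_edges_irrefl.
rewrite (cliques_inD1 _ e_sym e_irr (in_setT ord_max)).
have old_edge (i j : 'I_N.+1) : i < N -> j < N -> i != j %[mod r.+2] -> e i j.
  move=> iN jN nij; case: (ltngtP i j) => [ij|ji|ij]; last by rewrite ij eqxx in nij.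
    by apply: edge; rewrite ?jN.
  by rewrite e_sym; apply: edge; [exact: ji | rewrite eq_sym | rewrite iN].
have [M MN cM] := cross_count_ivt (ltac:(rewrite cross_count_self //; exact: ltnW cN)
  : c <= cross_count r.+2 N N).
pose eN := Ordinal (ltn_pmod N (ltn0Sn r.+1)).
apply: leq_add.
  have allK i : predT i = (Ordinal (ltn_pmod i (ltn0Sn r.+1)) \in setT) by rewrite in_setT.
  have := cliques_in_residues t.+2 (leqnSn N) allK.
  rewrite count_predT size_iota cardsT card_ord => <-.
  apply: cliques_in_sub => [|i j].
    by apply/subsetP => i; rewrite !inE !andbT -val_eqE /= => iN; rewrite ltn_eqF.
  by rewrite !inE !andbT; exact: old_edge.
have otherK i : (i != N %[mod r.+2])
    = (Ordinal (ltn_pmod i (ltn0Sn r.+1)) \in [set~ eN]) by rewrite !inE.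
have := cliques_in_residues t.+1 (leqW MN) otherK.
rewrite -/(cross_count r.+2 N M) cM cardsC1 card_ord => <-.
apply: cliques_in_sub => [|i j].
  apply/subsetP => i; rewrite !inE /= => /andP[iM niN].
  rewrite e_sym; apply: edge => //=; first exact: leq_trans MN.
  by rewrite eqxx -cM cross_count_lt ?orbT.
rewrite !inE => /andP[iM _] /andP[jM _]; apply: old_edge.
  exact: leq_trans MN.
exact: leq_trans MN.
Qed.

Theorem theorem7p7 (n r : nat) (A : sgraph -> Prop)
    (A_graphs : forall H : sgraph, A H -> #|H| = n /\ clique_free r.+1 H)
    (m : nat) (m_max : max_num_edges A m)
    (G : sgraph) (AG : A G) (t : nat) (t_ge2 : 2 <= t) :
  num_cliques t G <= num_cliques t (CT r m) /\
  ((exists2 H : sgraph, A H & isomorphic H (CT r m)) ->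
     (exists2 H : sgraph, A H & num_cliques t H = num_cliques t (CT r m)) /\
     (isomorphic G (CT r m) -> num_cliques t G = num_cliques t (CT r m))).
Proof.
split; last first.
  case=> H AH iso; split; last exact: isomorphic_num_cliques.
  by exists H => //; exact: isomorphic_num_cliques.
have [_ /clique_free_eq0] := A_graphs G AG; rewrite !num_cliquesE => free.
have [r2|r2] := ltnP r 2.
  apply: leq_trans (cliques_in_le_turan t (@adj_sym G) (@adj_irrefl G) free) _.
  by rewrite turan_cliques_small // (leq_trans r2).
case: r r2 free {A_graphs} => [|[|r]] // _ free.
case: t t_ge2 => [|[|t]] // _.
have [N [c [cN dm]]] := colex_decomposition r m.
have := m_max.2 G AG; rewrite num_edgesE num_cliquesE dm => le_m.
apply: leq_trans (cliques_in_le_colex t (@adj_sym G) (@adj_irrefl G) free cN le_m) _.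
by rewrite -num_cliquesE; exact: CT_cliques_ge.
Qed.
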